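(* Consider the sequences $\{x^k\}$ and $\{t^k\}$ (and the corresponding directions $\{d^k\}$ and gradients $\{g_1^k\},\{g_2^k\}$) generated by Algorithm 1 (described in the context), and the following assumptions. (1) There are $\lambda_{max}\ge\lambda_{min}>0$ such that for all $k$ and $i\in\{1,2\}$ the matrix $H_i^k$ is symmetric positive definite with all eigenvalues in $[\lambda_{min},\lambda_{max}]$. (2) For each $i\in\{1,2\}$ and each $x=(x_i,x_{\neg i})\in\mathbb{R}^{n_1+n_2}$ there exist $\delta_x,L_x>0$ such that $\|\nabla_{x_i}f_i(y,x_{\neg i})-\nabla_{x_i}f_i(z,x_{\neg i})\|\le L_x\|y-z\|$ for all $y,z\in B(x_i,\delta_x)$. (3) For every iterate $x^k$ there exist $\hat\delta_k>0$, $C_R^k>0$ and functions $r_i^k:\mathbb{R}\times\mathbb{R}^{n_{\neg i}}\to\mathbb{R}^{n_i}$, $i=1,2$, such that for all $d_{\neg i}\in\mathbb{R}^{n_{\neg i}}$ and $t>0$ with $\|td_{\neg i}\|\le\hat\delta_k$, $$\nabla_{x_i}f_i(x_i^k,x_{\neg i}^k+td_{\neg i})=\nabla_{x_i}f_i(x^k)+t\nabla^2_{x_ix_{\neg i}}f_i(x^k)d_{\neg i}+r_i^k(t,d_{\neg i}),\qquad\|r_i^k(t,d_{\neg i})\|\le C_R^kt^2\|d_{\neg i}\|^2.$$ Then the following holds: i) If $\lim_{k\in\mathbb{N}'}d^k=0$ and if the mixed Hessians $\nabla^2_{x_1x_2}f_1(x^k)$, $\nabla^2_{x_2x_1}f_2(x^k)$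 are uniformly bounded on an infinite subset $\mathbb{N}'\subset\mathbb{N}$, then the sequences of gradients $\{g_1^k\}$ and $\{g_2^k\}$ converge to zero on the same subset. ii) If (1), (2) and (3) hold and the whole sequence $\{x^k\}$ converges to a point $x^*$, then either $\nabla_{x_1}f_1(x^* )=0$ or $\nabla_{x_2}f_2(x^* )=0$. iii) Suppose that (1), (2) and (3) hold, and that the third derivatives of the objective functions $f_1,f_2$ always exist and are continuous. If $\{x^k\}$ converges to a point $x^*$ and if in addition the sequence of step-sizes $\{t^k\}$ is bounded away from zero, then $x^*$ is stationary for the NEP, that is, $\nabla_{x_1}f_1(x^* )=0$ and $\nabla_{x_2}f_2(x^* )=0$.
   Context: Setting. $f_1,f_2:\mathbb{R}^{n_1}\times\mathbb{R}^{n_2}\to\mathbb{R}$ are twice continuously differentiable (possibly non-convex). In the two-player Nash equilibrium problem (NEP), player $i\in\{1,2\}$ minimizes $f_i(x_1,x_2)$ over $x_i\in\mathbb{R}^{n_i}$. $\neg i$ denotes the other player; $f_i(x_i,x_{\neg i})$ is the value of $f_i$ at the point with blocks $x_i,x_{\neg i}$. $\nabla_{x_i}f$ is the partial gradient and $\nabla^2_{x_ix_j}f$ the partial Hessian ($n_i\times n_j$). $\|\cdot\|$ is the 2-norm of vectors and matrices; $B(x,\delta)$ is the closed ball. Algorithm 1. Given $x^0=(x_1^0,x_2^0)$, $\alpha\in(0,1)$, $\tau\in(0,1]$, $\theta>0$, $\gamma>0$. At iteration $k=0,1,2,\dots$ with iterate $x^k=(x_1^k,x_2^k)$: set $g_i^k=\nabla_{x_i}f_i(x^k)$,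 choose symmetric positive definite $H_1^k,H_2^k$, set $t:=1$. (a) For $i=1,2$: $M_i:=\nabla^2_{x_ix_{\neg i}}f_i(x^k)$ if $\|g_i^k\|>0$ or $t>\tau$, and $M_i:=0$ otherwise. (b) Let $\mathcal{H}_{t,k}=\begin{pmatrix}H_1^k & t M_1 \\ t M_2 & H_2^k\end{pmatrix}$. If singular, set $t:=t/2$ and repeat (b). (c) Let $d=(d_1,d_2)$ solve $\mathcal{H}_{t,k}d=-g^k$, where $g^k=(g_1^k,g_2^k)$. (d) Check, for both $i=1,2$: Armijo: $f_i(x^k+td)\le f_i(x_i^k,x_{\neg i}^k+td_{\neg i})+\alpha t\nabla_{x_i}f_i(x_i^k,x_{\neg i}^k+td_{\neg i})^Td_i$; angle: $\nabla_{x_i}f_i(x_i^k,x_{\neg i}^k+td_{\neg i})^Td_i\le-\theta\|\nabla_{x_i}f_i(x_i^k,x_{\neg i}^k+td_{\neg i})\|\,\|d_i\|$; size: $\gamma\|\nabla_{x_i}f_i(x_i^k,x_{\neg i}^k+td_{\neg i})\|\,\|g_i^k\|\le\|d_i\|\,\|g_i^k\|$. If one fails, set $t:=t/2$ and go to (a). (e) Otherwise set $t^k:=t$, $M_i^k:=M_i$, $d^k:=d$, $x^{k+1}:=x^k+t^kd^k$ and go to the next iteration.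
   Formalization: Part ii) additionally assumes θ < 2√(λmin λmax)/(λmin+λmax) and γ < 1/λmax; for arbitrary θ, γ > 0 it is false (e.g. γ = 1/λmax, f1 = (1+x2²)x1, f2 = −x2). Part i) is stated under assumption (1). *)

(* Defs.v *)
From HB Require Import structures.
From mathcomp Require Import all_boot all_order all_algebra.
From mathcomp Require Import all_classical all_reals all_analysis.

Set Implicit Arguments.
Unset Strict Implicit.
Unset Printing Implicit Defensive.

Import Order.TTheory GRing.Theory Num.Theory.
Import numFieldNormedType.Exports.

Local Open Scope classical_set_scope.
Local Open Scope ring_scope.

(* The norm [`|_|] carried by matrices in the library is the max norm; it is
   used below only through the topology it induces.  Every quantitative
   condition uses the 2-norms [norm2] and [mxnorm2]. *)
Definition dot (R : realType) (n : nat) (u v : 'cV[R]_n) : R :=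
  \sum_(i < n) u i 0 * v i 0.

Definition norm2 (R : realType) (n : nat) (u : 'cV[R]_n) : R :=
  Num.sqrt (dot u u).

Definition mxnorm2 (R : realType) (m n : nat) (A : 'M[R]_(m, n)) : R :=
  sup [set norm2 (A *m v) | v in [set v : 'cV[R]_n | norm2 v <= 1]].

(* [Ck k f]: f is k times continuously differentiable on the whole space
   (the derivatives of order j are the iterated directional derivatives). *)
Fixpoint Ck (R : realType) (V : normedModType R) (k : nat) (f : V -> R)
    : Prop :=
  match k with
  | 0%N => continuous f
  | k'.+1 => (forall x, differentiable f x) /\
             (forall v : V, Ck k' (fun x => 'D_v f x))
  end.

(* A player's objective is written with the player's own block first,
   F x y = f_i(x_i, x_{-i}). *)
Definition own1 (R : realType) (n1 n2 : nat)
    (f : 'cV[R]_n1 * 'cV[R]_n2 -> R) : 'cV[R]_n1 -> 'cV[R]_n2 -> R :=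
  fun x1 x2 => f (x1, x2).

Definition own2 (R : realType) (n1 n2 : nat)
    (f : 'cV[R]_n1 * 'cV[R]_n2 -> R) : 'cV[R]_n2 -> 'cV[R]_n1 -> R :=
  fun x2 x1 => f (x1, x2).

Definition pgrad (R : realType) (n m : nat)
    (F : 'cV[R]_n -> 'cV[R]_m -> R) (x : 'cV[R]_n) (y : 'cV[R]_m)
    : 'cV[R]_n :=
  \col_(a < n) 'D_(delta_mx a 0) (fun z => F z y) x.

(* Mixed partial Hessian: the (a, b) entry is the derivative of the a-th
   component of the own gradient in the b-th variable of the other player. *)
Definition phess (R : realType) (n m : nat)
    (F : 'cV[R]_n -> 'cV[R]_m -> R) (x : 'cV[R]_n) (y : 'cV[R]_m)
    : 'M[R]_(n, m) :=
  \matrix_(a < n, b < m) 'D_(delta_mx b 0) (fun w => pgrad F x w a 0) y.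

Definition spd (R : realType) (n : nat) (H : 'M[R]_n) : Prop :=
  H^T = H /\ (forall v : 'cV[R]_n, v != 0 -> 0 < dot v (H *m v)).

Definition mixed_block (R : realType) (n m : nat)
    (F : 'cV[R]_n -> 'cV[R]_m -> R) (tau t : R)
    (x : 'cV[R]_n) (y : 'cV[R]_m) : 'M[R]_(n, m) :=
  if (0 < norm2 (pgrad F x y)) || (tau < t) then phess F x y else 0.

Definition newton_mx (R : realType) (n1 n2 : nat)
    (H1 : 'M[R]_n1) (H2 : 'M[R]_n2)
    (M1 : 'M[R]_(n1, n2)) (M2 : 'M[R]_(n2, n1)) (t : R) : 'M[R]_(n1 + n2) :=
  block_mx H1 (t *: M1) (t *: M2) H2.

Definition newton_direction (R : realType) (n1 n2 : nat)
    (f1 f2 : 'cV[R]_n1 * 'cV[R]_n2 -> R)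
    (H1 : 'M[R]_n1) (H2 : 'M[R]_n2)
    (M1 : 'M[R]_(n1, n2)) (M2 : 'M[R]_(n2, n1)) (t : R)
    (x d : 'cV[R]_n1 * 'cV[R]_n2) : Prop :=
  newton_mx H1 H2 M1 M2 t *m col_mx d.1 d.2 =
  - col_mx (pgrad (own1 f1) x.1 x.2) (pgrad (own2 f2) x.2 x.1).

(* The Armijo, angle and size conditions of one player, with own block x,
   own direction d, other block y and other direction e. *)
Definition player_tests (R : realType) (n m : nat)
    (F : 'cV[R]_n -> 'cV[R]_m -> R) (alpha theta gamma t : R)
    (x d : 'cV[R]_n) (y e : 'cV[R]_m) : Prop :=
  let y' := y + t *: e in
  let g' := pgrad F x y' in
  [/\ F (x + t *: d) y' <= F x y' + alpha * t * dot g' d,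
      dot g' d <= - theta * norm2 g' * norm2 d
    & gamma * norm2 g' * norm2 (pgrad F x y) <=
      norm2 d * norm2 (pgrad F x y)].

Definition line_search_tests (R : realType) (n1 n2 : nat)
    (f1 f2 : 'cV[R]_n1 * 'cV[R]_n2 -> R) (alpha theta gamma t : R)
    (x d : 'cV[R]_n1 * 'cV[R]_n2) : Prop :=
  player_tests (own1 f1) alpha theta gamma t x.1 d.1 x.2 d.2 /\
  player_tests (own2 f2) alpha theta gamma t x.2 d.2 x.1 d.1.

(* [inner_state .. t M1 M2]: the inner loop at the iterate x reaches the
   singularity check with trial step size t and blocks M1, M2.  After a
   singular matrix only t is halved and M1, M2 are kept, whereas after a
   failed test M1, M2 are selected again with the halved t. *)
Inductive inner_state (R : realType) (n1 n2 : nat)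
    (f1 f2 : 'cV[R]_n1 * 'cV[R]_n2 -> R) (alpha tau theta gamma : R)
    (H1 : 'M[R]_n1) (H2 : 'M[R]_n2) (x : 'cV[R]_n1 * 'cV[R]_n2)
    : R -> 'M[R]_(n1, n2) -> 'M[R]_(n2, n1) -> Prop :=
| inner_start :
    inner_state f1 f2 alpha tau theta gamma H1 H2 x 1
      (mixed_block (own1 f1) tau 1 x.1 x.2)
      (mixed_block (own2 f2) tau 1 x.2 x.1)
| inner_singular t M1 M2 :
    inner_state f1 f2 alpha tau theta gamma H1 H2 x t M1 M2 ->
    newton_mx H1 H2 M1 M2 t \notin unitmx ->
    inner_state f1 f2 alpha tau theta gamma H1 H2 x (t / 2) M1 M2
| inner_reject t M1 M2 d :
    inner_state f1 f2 alpha tau theta gamma H1 H2 x t M1 M2 ->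
    newton_mx H1 H2 M1 M2 t \in unitmx ->
    newton_direction f1 f2 H1 H2 M1 M2 t x d ->
    ~ line_search_tests f1 f2 alpha theta gamma t x d ->
    inner_state f1 f2 alpha tau theta gamma H1 H2 x (t / 2)
      (mixed_block (own1 f1) tau (t / 2) x.1 x.2)
      (mixed_block (own2 f2) tau (t / 2) x.2 x.1).

Definition algorithm_step (R : realType) (n1 n2 : nat)
    (f1 f2 : 'cV[R]_n1 * 'cV[R]_n2 -> R) (alpha tau theta gamma : R)
    (H1 : 'M[R]_n1) (H2 : 'M[R]_n2) (x : 'cV[R]_n1 * 'cV[R]_n2)
    (t : R) (d xnext : 'cV[R]_n1 * 'cV[R]_n2) : Prop :=
  exists (M1 : 'M[R]_(n1, n2)) (M2 : 'M[R]_(n2, n1)),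
    [/\ inner_state f1 f2 alpha tau theta gamma H1 H2 x t M1 M2,
        newton_mx H1 H2 M1 M2 t \in unitmx,
        newton_direction f1 f2 H1 H2 M1 M2 t x d,
        line_search_tests f1 f2 alpha theta gamma t x d
      & xnext = x + t *: d].

Definition generated_by_algorithm (R : realType) (n1 n2 : nat)
    (f1 f2 : 'cV[R]_n1 * 'cV[R]_n2 -> R) (alpha tau theta gamma : R)
    (H1 : nat -> 'M[R]_n1) (H2 : nat -> 'M[R]_n2)
    (x : nat -> 'cV[R]_n1 * 'cV[R]_n2) (t : nat -> R)
    (d : nat -> 'cV[R]_n1 * 'cV[R]_n2) : Prop :=
  forall k, [/\ spd (H1 k), spd (H2 k) &
    algorithm_step f1 f2 alpha tau theta gamma (H1 k) (H2 k)
      (x k) (t k) (d k) (x k.+1)].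

Definition eigenvalues_within (R : realType) (lmin lmax : R) (n : nat)
    (H : 'M[R]_n) : Prop :=
  forall a : R, eigenvalue H a -> lmin <= a <= lmax.

Definition uniformly_spd (R : realType) (n1 n2 : nat) (lmin lmax : R)
    (H1 : nat -> 'M[R]_n1) (H2 : nat -> 'M[R]_n2) : Prop :=
  [/\ 0 < lmin, lmin <= lmax &
    forall k, [/\ spd (H1 k), eigenvalues_within lmin lmax (H1 k),
                  spd (H2 k) & eigenvalues_within lmin lmax (H2 k)]].

Definition locally_lipschitz_grad (R : realType) (n m : nat)
    (F : 'cV[R]_n -> 'cV[R]_m -> R) : Prop :=
  forall (x : 'cV[R]_n) (y : 'cV[R]_m),
    exists delta L : R, [/\ 0 < delta, 0 < L &
      forall u v : 'cV[R]_n, norm2 (u - x) <= delta -> norm2 (v - x) <= delta ->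
        norm2 (pgrad F u y - pgrad F v y) <= L * norm2 (u - v)].

Definition grad_expansion (R : realType) (n m : nat)
    (F : 'cV[R]_n -> 'cV[R]_m -> R) (x : 'cV[R]_n) (y : 'cV[R]_m)
    (delta C : R) (r : R -> 'cV[R]_m -> 'cV[R]_n) : Prop :=
  forall (e : 'cV[R]_m) (t : R), 0 < t -> norm2 (t *: e) <= delta ->
    pgrad F x (y + t *: e) =
      pgrad F x y + t *: (phess F x y *m e) + r t e /\
    norm2 (r t e) <= C * t ^+ 2 * norm2 e ^+ 2.

Definition grad_expansions (R : realType) (n1 n2 : nat)
    (f1 f2 : 'cV[R]_n1 * 'cV[R]_n2 -> R)
    (x : nat -> 'cV[R]_n1 * 'cV[R]_n2) : Prop :=
  forall k, exists (delta C : R) (r1 : R -> 'cV[R]_n2 -> 'cV[R]_n1)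
      (r2 : R -> 'cV[R]_n1 -> 'cV[R]_n2),
    [/\ 0 < delta, 0 < C,
        grad_expansion (own1 f1) (x k).1 (x k).2 delta C r1
      & grad_expansion (own2 f2) (x k).2 (x k).1 delta C r2].

(* Compatibility of the angle and size parameters with the bounds on the H_i.
   Every v <> 0 and symmetric H with eigenvalues in [lmin, lmax] satisfy
   v^T H^-1 v >= 2 sqrt(lmin lmax) / (lmin + lmax) * |v| * |H^-1 v|
   (Kantorovich) and |H^-1 v| >= |v| / lmax, so this says that -H^-1 v, the
   limit of the search direction as t -> 0, passes both tests strictly.
   Without it the tests can force t^k -> 0 and convergence to a point where
   both gradients are nonzero, e.g. for n1 = n2 = 1,
   f1 = (1 + x2^2) x1, f2 = - x2, gamma = 1, theta <= 1,
   H1^k = 1 / (1 + 4^-(k+1)), H2^k = 1 / 2 and x^0 = 0: then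
   t^k = 2^-(k+2), d2^k = 2 and x2^k = 1 - 2^-k. *)
Definition small_parameters (R : realType) (lmin lmax theta gamma : R)
    : Prop :=
  theta < 2 * Num.sqrt (lmin * lmax) / (lmin + lmax) /\ gamma < lmax^-1.

(* Main.v *)
Require Import Defs.
From HB Require Import structures.
From mathcomp Require Import all_boot all_order all_algebra.
From mathcomp Require Import all_classical all_reals all_analysis.
From mathcomp Require Import ring lra.

Set Implicit Arguments.
Unset Strict Implicit.
Unset Printing Implicit Defensive.

Import Order.TTheory GRing.Theory Num.Theory.
Import numFieldNormedType.Exports.

Local Open Scope classical_set_scope.
Local Open Scope ring_scope.

(** If the step sizes along a convergent sequence of iterates stay away from
    zero, the directions [d k = (t k)^-1 *: (x k.+1 - x k)] tend to zero
    ([long_steps_stationary]).  The two block rows of the Newton system express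
    the gradients through [d k] with bounded coefficients: the matrices [H1 k]
    and [H2 k] have bounded eigenvalues, the steps are at most 1, and the mixed
    Hessians are bounded, by assumption in part i) and by continuity near the
    limit in part iii).  So the gradients tend to zero with [d k]
    ([gradients_cvg0]), which is part i), and by continuity they vanish at the
    limit, which is part iii).

    For part ii) suppose that both gradients are nonzero at the limit.  Then
    step sizes are bounded below ([steps_bounded_below]), and the previous
    paragraph gives a contradiction.  Indeed, near the limit the mixed blocks are
    the Hessians, which are bounded, so for all sufficiently small trial steps
    the Newton matrix is invertible and the direction of each player is close to
    [- H^-1 g].  The latter passes the angle and size tests strictly, by the
    Kantorovich inequality and the assumed relation between the parameters and
    the eigenvalue bounds; this survives a small perturbation, and the Armijo
    test follows by the mean value theorem ([perturbed_direction_tests],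
    [short_step_tests]).  A trial step below a threshold that does not depend on
    the iterate is therefore never halved ([inner_state_step_ge]).

    The eigenvalue bounds are used as bounds on quadratic forms: the maximum of
    a form on the unit sphere is attained at an eigenvector ([rayleigh_le]). *)

(** * Euclidean geometry and Rayleigh quotients *)

Section Euclidean.
Context {R : realType}.

Lemma dotC n (u v : 'cV[R]_n) : dot u v = dot v u.
Proof. by apply: eq_bigr => i _; rewrite mulrC. Qed.

Lemma dotDl n (u v w : 'cV[R]_n) : dot (u + v) w = dot u w + dot v w.
Proof. by rewrite -big_split; apply: eq_bigr => i _; rewrite mxE mulrDl. Qed.

Lemma dotZl n a (u v : 'cV[R]_n) : dot (a *: u) v = a * dot u v.
Proof. by rewrite mulr_sumr; apply: eq_bigr => i _; rewrite mxE mulrA. Qed.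

Lemma dotDr n (u v w : 'cV[R]_n) : dot w (u + v) = dot w u + dot w v.
Proof. by rewrite dotC dotDl !(dotC w). Qed.

Lemma dotZr n a (u v : 'cV[R]_n) : dot u (a *: v) = a * dot u v.
Proof. by rewrite dotC dotZl dotC. Qed.

Lemma dot0 n : dot (0 : 'cV[R]_n) 0 = 0.
Proof. by rewrite -(scale0r 0) dotZl mul0r. Qed.

Lemma dotNl n (u v : 'cV[R]_n) : dot (- u) v = - dot u v.
Proof. by rewrite -scaleN1r dotZl mulN1r. Qed.

Lemma dotNr n (u v : 'cV[R]_n) : dot u (- v) = - dot u v.
Proof. by rewrite dotC dotNl dotC. Qed.

Lemma dotBl n (u v w : 'cV[R]_n) : dot (u - v) w = dot u w - dot v w.
Proof. by rewrite dotDl dotNl. Qed.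

Lemma dotBr n (u v w : 'cV[R]_n) : dot w (u - v) = dot w u - dot w v.
Proof. by rewrite dotDr dotNr. Qed.

Lemma dotE n (u v : 'cV[R]_n) : dot u v = (u^T *m v) 0 0.
Proof. by rewrite mxE; apply: eq_bigr => i _; rewrite mxE. Qed.

Lemma dot_mulmxr m n (A : 'M[R]_(m, n)) (u : 'cV[R]_m) (v : 'cV[R]_n) :
  dot u (A *m v) = dot (A^T *m u) v.
Proof. by rewrite !dotE trmx_mul trmxK mulmxA. Qed.

Lemma dot_ge0 n (u : 'cV[R]_n) : 0 <= dot u u.
Proof. by apply: sumr_ge0 => i _; rewrite -expr2 sqr_ge0. Qed.

Lemma dot_eq0 n (u : 'cV[R]_n) : (dot u u == 0) = (u == 0).
Proof.
rewrite /dot psumr_eq0; last by move=> i _; rewrite -expr2 sqr_ge0.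
apply/allP/eqP => [u0|-> i _]; last by rewrite /= mxE mul0r eqxx.
apply/colP => i; rewrite mxE; apply/eqP.
by have := u0 i (mem_index_enum _); rewrite /= mulf_eq0 orbb.
Qed.

Lemma norm2_ge0 n (u : 'cV[R]_n) : 0 <= norm2 u.
Proof. exact: sqrtr_ge0. Qed.

Lemma norm2_sqr n (u : 'cV[R]_n) : norm2 u ^+ 2 = dot u u.
Proof. by rewrite sqr_sqrtr ?dot_ge0. Qed.

Lemma norm2_eq0 n (u : 'cV[R]_n) : (norm2 u == 0) = (u == 0).
Proof. by rewrite -dot_eq0 -norm2_sqr sqrf_eq0. Qed.

Lemma norm2_gt0 n (u : 'cV[R]_n) : (0 < norm2 u) = (u != 0).
Proof. by rewrite lt_def norm2_ge0 andbT norm2_eq0. Qed.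

Lemma norm2Z n a (u : 'cV[R]_n) : norm2 (a *: u) = `|a| * norm2 u.
Proof.
by rewrite /norm2 dotZl dotZr mulrA -expr2 sqrtrM ?sqr_ge0// sqrtr_sqr.
Qed.

Lemma norm2N n (u : 'cV[R]_n) : norm2 (- u) = norm2 u.
Proof. by rewrite -scaleN1r norm2Z normrN1 mul1r. Qed.

Lemma norm2_0 n : norm2 (0 : 'cV[R]_n) = 0.
Proof. by apply/eqP; rewrite norm2_eq0. Qed.

(** Nonnegativity of the quadratic polynomial
    [s |-> dot (u + s *: v) (A *m (u + s *: v))] bounds its discriminant. *)
Lemma psd_CauchySchwarz n (A : 'M[R]_n) (u v : 'cV[R]_n) :
  A^T = A -> (forall w, 0 <= dot w (A *m w)) ->
  dot u (A *m v) ^+ 2 <= dot u (A *m u) * dot v (A *m v).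
Proof.
move=> symA psdA.
have uvC : dot v (A *m u) = dot u (A *m v) by rewrite dot_mulmxr symA dotC.
set a := dot u (A *m u); set b := dot u (A *m v); set c := dot v (A *m v).
have quad s r : 0 <= s ^+ 2 * a + 2 * s * r * b + r ^+ 2 * c.
  have := psdA (s *: u + r *: v).
  rewrite mulmxDr -!scalemxAr !dotDl !dotDr !dotZl !dotZr uvC -/a -/b -/c.
  by congr (_ <= _); ring.
have c0 : 0 <= c by exact: psdA.
have [cp|] := ltP 0 c.
  have := quad c (- b); rewrite (_ : _ + _ = c * (a * c - b ^+ 2)); last by ring.
  by rewrite pmulr_rge0// subr_ge0.
rewrite le_eqVlt ltNge c0 orbF => /eqP c_0; rewrite c_0 mulr0.
have [->|b0] := eqVneq b 0; first by rewrite expr0n.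
(* For [c = 0] the polynomial is affine in [r], and this root of
   [a + 2 * r * b = -1] makes it negative. *)
have := quad 1 (- (a + 1) / (2 * b)); rewrite c_0.
rewrite (_ : _ + _ = -1); last by field.
by rewrite lerNr oppr0 ler10.
Qed.

Lemma dot_CauchySchwarz n (u v : 'cV[R]_n) : `|dot u v| <= norm2 u * norm2 v.
Proof.
rewrite -ler_sqr ?nnegrE ?mulr_ge0 ?norm2_ge0//.
rewrite exprMn !norm2_sqr real_normK ?num_real//.
have := @psd_CauchySchwarz n 1%:M u v (trmx1 _ _).
by rewrite !mul1mx; apply=> w; rewrite mul1mx dot_ge0.
Qed.

Lemma norm2D n (u v : 'cV[R]_n) : norm2 (u + v) <= norm2 u + norm2 v.
Proof.
rewrite -ler_sqr ?nnegrE ?addr_ge0 ?norm2_ge0// sqrrD !norm2_sqr.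
rewrite !dotDl !dotDr (dotC v u).
have := le_trans (ler_norm _) (dot_CauchySchwarz u v); lra.
Qed.

Lemma norm2B n (u v : 'cV[R]_n) : norm2 (u - v) <= norm2 u + norm2 v.
Proof. by rewrite (le_trans (norm2D _ _))// norm2N. Qed.

(** A maximizer of the quadratic form on the unit sphere, which exists by
    compactness, is an eigenvector: [mu%:M - A] is positive semidefinite and
    vanishes at it, so by the Cauchy-Schwarz inequality it is in the kernel. *)
Lemma rayleigh_le n (A : 'M[R]_n) (c : R) :
  A^T = A -> (forall a, eigenvalue A a -> a <= c) ->
  forall v, dot v (A *m v) <= c * dot v v.
Proof.
move=> symA eigA v.
have [->|v0] := eqVneq v 0; first by rewrite mulmx0 dot0 mulr0.
(* Row vectors, because the Heine-Borel theorem is stated for them. *)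
pose q (w : 'rV[R]_n) := dot w^T (A *m w^T).
pose S := [set w : 'rV[R]_n | dot w^T w^T = 1].
have normal (w : 'cV[R]_n) : w != 0 -> S ((norm2 w)^-1 *: w)^T.
  move=> w0; rewrite /S /= trmxK dotZl dotZr -norm2_sqr.
  by field; rewrite norm2_eq0.
have sumc (F : 'I_n -> 'rV[R]_n -> R) :
    (forall i, continuous (F i)) -> continuous (fun w => \sum_i F i w).
  by move=> Fc; apply: continuous_big => //; exact: add_continuous.
have coordc i : continuous (fun w : 'rV[R]_n => w^T i 0).
  move=> w; rewrite /continuous_at mxE; under eq_fun do rewrite mxE.
  exact: coord_continuous.
have mulc (f g : 'rV[R]_n -> R) :
    continuous f -> continuous g -> continuous (fun w => f w * g w).
  by move=> fc gc w; apply: continuousM; [exact: fc|exact: gc].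
have qc : continuous q.
  apply: (sumc) => i; apply: (mulc); first exact: (coordc).
  rewrite (_ : (fun _ => _) = fun w : 'rV[R]_n => \sum_j A i j * w^T j 0).
    by apply: (sumc) => j; apply: (mulc); [exact: cst_continuous|exact: (coordc)].
  by apply/funext => w; rewrite mxE.
have dc : continuous (fun w : 'rV[R]_n => dot w^T w^T).
  by apply: (sumc) => i; apply: (mulc); exact: (coordc).
have S0 : S !=set0 by exists ((norm2 v)^-1 *: v)^T; exact: normal.
have cS : compact S.
  apply: bounded_closed_compact; last first.
    by move/continuous_closedP: dc => /(_ [set y | y = 1]); apply; exact: closed_eq.
  exists 1; split => // M M1 w Sw; apply/ltW; apply: le_lt_trans M1.
  rewrite /Num.norm/= mx_normrE; apply/bigmax_leP; split => // -[i j] _ /=.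
  rewrite -(@ler_pXn2r _ 2)// ?nnegrE// expr1n real_normK ?num_real//.
  rewrite -Sw /dot (bigD1 j)//= !mxE (ord1 i) expr2 lerDl.
  by apply: sumr_ge0 => k _; rewrite -expr2 sqr_ge0.
have [w Sw wmax] := @EVT_max_rV _ _ q S S0 cS (continuous_subspaceT qc).
have Sw1 : dot w^T w^T = 1 by exact: set_mem Sw.
pose mu := q w.
have mumax u : dot u (A *m u) <= mu * dot u u.
  have [->|u0] := eqVneq u 0; first by rewrite mulmx0 dot0 mulr0.
  have up : 0 < norm2 u by rewrite norm2_gt0.
  have := wmax _ (mem_set (normal u u0)).
  rewrite /q trmxK -scalemxAr dotZl dotZr -/mu mulrA -expr2 -norm2_sqr.
  by rewrite exprVn mulrC ler_pdivrMr ?exprn_gt0.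
have BE u u' : dot u' ((mu%:M - A) *m u) = mu * dot u' u - dot u' (A *m u).
  by rewrite mulmxBl mul_scalar_mx dotBr dotZr.
have wker : (mu%:M - A) *m w^T = 0.
  apply/eqP; rewrite -dot_eq0 -sqrf_eq0 eq_le sqr_ge0 andbT.
  have := @psd_CauchySchwarz n (mu%:M - A) ((mu%:M - A) *m w^T) w^T.
  rewrite [X in _ -> _ -> _ <= _ * X]BE.
  have -> : mu * dot w^T w^T - dot w^T (A *m w^T) = 0 by rewrite Sw1 mulr1 subrr.
  rewrite mulr0; apply; first by rewrite linearB /= tr_scalar_mx symA.
  by move=> u; rewrite BE subr_ge0.
apply: le_trans (mumax v) _; apply: ler_wpM2r; first exact: dot_ge0.
apply: eigA; apply/eigenvalueP; exists w; last first.
  by apply: contra_eq_neq Sw1 => ->; rewrite trmx0 dot0 eq_sym oner_eq0.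
apply: trmx_inj; rewrite trmx_mul symA linearZ /=.
by move/eqP: wker; rewrite mulmxBl mul_scalar_mx subr_eq0 => /eqP.
Qed.

Lemma rayleigh_ge n (A : 'M[R]_n) (c : R) :
  A^T = A -> (forall a, eigenvalue A a -> c <= a) ->
  forall v, c * dot v v <= dot v (A *m v).
Proof.
move=> symA eigA v.
have := @rayleigh_le n (- A) (- c) _ _ v; rewrite mulNmx dotNr mulNr lerN2.
apply; first by rewrite linearN /= symA.
move=> a /eigenvalueP[w wA w0]; rewrite lerNr; apply: eigA.
by apply/eigenvalueP; exists w => //; rewrite scaleNr -wA mulmxN opprK.
Qed.

End Euclidean.

(** * Quadratic forms between two multiples of the identity *)

(** Eigenvalues enter the argument only through these two-sided bounds on the
    quadratic form, which spare a diagonalization. *)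
Definition form_between {R : realType} n (lmin lmax : R) (H : 'M[R]_n) : Prop :=
  H^T = H /\
  forall v, lmin * dot v v <= dot v (H *m v) /\ dot v (H *m v) <= lmax * dot v v.

Lemma eigenvalues_form_between {R : realType} n (lmin lmax : R) (H : 'M[R]_n) :
  spd H -> eigenvalues_within lmin lmax H -> form_between lmin lmax H.
Proof.
move=> [symH _] eigH; split=> // v; split.
  by apply: rayleigh_ge => // a /eigH/andP[].
by apply: rayleigh_le => // a /eigH/andP[].
Qed.

Section FormBounds.
Context {R : realType} (n : nat) (lmin lmax : R) (H : 'M[R]_n).
Hypotheses (lmin_gt0 : 0 < lmin) (lmax_gt0 : 0 < lmax).
Hypothesis formH : form_between lmin lmax H.

Let symH : H^T = H. Proof. by case: formH. Qed.

Let geH (v : 'cV[R]_n) : lmin * dot v v <= dot v (H *m v).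
Proof. by have [] := formH.2 v. Qed.

Let leH (v : 'cV[R]_n) : dot v (H *m v) <= lmax * dot v v.
Proof. by have [] := formH.2 v. Qed.

(** This is the positivity of [(H - lmin) (lmax - H)], obtained from the
    Cauchy-Schwarz inequality of the form of [H - lmin] at [v] and its image. *)
Lemma form_interlace (v : 'cV[R]_n) :
  dot (H *m v) (H *m v) + lmin * lmax * dot v v <=
  (lmin + lmax) * dot v (H *m v).
Proof.
pose A := H - lmin%:M.
have AE u : A *m u = H *m u - lmin *: u by rewrite mulmxBl mul_scalar_mx.
have qA u : dot u (A *m u) = dot u (H *m u) - lmin * dot u u.
  by rewrite AE dotBr dotZr.
have psdA u : 0 <= dot u (A *m u) by rewrite qA subr_ge0.
have symA : A^T = A by rewrite linearB /= tr_scalar_mx symH.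
set w := A *m v.
have : dot w w <= (lmax - lmin) * dot v w.
  have [->|w0] := eqVneq w 0; first by rewrite -(scale0r 0) !dotZr !mul0r mulr0.
  have wp : 0 < dot w w by rewrite lt_def dot_eq0 w0 dot_ge0.
  rewrite -(ler_pM2l wp) -expr2.
  apply: (le_trans (psd_CauchySchwarz _ _ symA psdA)).
  rewrite mulrA; apply: ler_wpM2r; first exact: psdA.
  by rewrite qA mulrBr mulrC [X in _ <= X - _]mulrC lerB // mulrC.
rewrite /w qA AE dotBl !dotBr !dotZl !dotZr (dotC (H *m v) v); lra.
Qed.

Lemma norm2_form_le (v : 'cV[R]_n) : norm2 (H *m v) <= lmax * norm2 v.
Proof.
rewrite -ler_sqr ?nnegrE ?mulr_ge0 ?norm2_ge0 ?(ltW lmax_gt0)// exprMn !norm2_sqr.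
have fi := form_interlace v.
have sp : 0 <= lmin + lmax by rewrite addr_ge0 ?ltW.
have := ler_wpM2l sp (leH v); lra.
Qed.

Lemma norm2_form_ge (v : 'cV[R]_n) : lmin * norm2 v <= norm2 (H *m v).
Proof.
have [->|v0] := eqVneq v 0; first by rewrite norm2_0 mulr0 norm2_ge0.
have vp : 0 < norm2 v by rewrite norm2_gt0.
rewrite -(ler_pM2l vp) mulrCA -expr2 norm2_sqr (le_trans (geH v))//.
by apply: (le_trans (ler_norm _)); exact: dot_CauchySchwarz.
Qed.

(** The Kantorovich inequality, by the arithmetic-geometric mean inequality
    applied to the left-hand side of [form_interlace]. *)
Lemma kantorovich (v : 'cV[R]_n) :
  2 * Num.sqrt (lmin * lmax) / (lmin + lmax) * (norm2 (H *m v) * norm2 v) <=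
  dot v (H *m v).
Proof.
have := form_interlace v; set s := Num.sqrt _ => fi.
have s2 : s ^+ 2 = lmin * lmax by rewrite sqr_sqrtr// mulr_ge0 ?ltW.
have sp : 0 < lmin + lmax by rewrite addr_gt0.
rewrite mulrAC ler_pdivrMr// mulrC [X in _ <= X]mulrC; apply: le_trans fi.
rewrite -!norm2_sqr -s2 -subr_ge0.
by rewrite (_ : _ - _ = (norm2 (H *m v) - s * norm2 v) ^+ 2) ?sqr_ge0//; ring.
Qed.

End FormBounds.

(** * Comparison of the norms *)

Section MatrixNorms.
Context {R : realType}.

Lemma mx_entry_le m n (A : 'M[R]_(m, n)) i j : `|A i j| <= `|A|.
Proof.
rewrite [X in _ <= X]/Num.norm/= mx_normrE.
exact: (le_bigmax _ (fun k : 'I_m * 'I_n => `|A k.1 k.2|) (i, j)).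
Qed.

Lemma mx_norm_le m n (A : 'M[R]_(m, n)) c :
  0 <= c -> (forall i j, `|A i j| <= c) -> `|A| <= c.
Proof.
move=> c0 Ac; rewrite /Num.norm/= mx_normrE.
by apply/bigmax_leP; split => // -[i j] _; exact: Ac.
Qed.

Lemma norm_le_norm2 n (u : 'cV[R]_n) : `|u| <= norm2 u.
Proof.
apply: mx_norm_le => [|i j]; first exact: norm2_ge0.
rewrite (ord1 j) -ler_sqr ?nnegrE ?norm2_ge0// norm2_sqr real_normK ?num_real//.
rewrite /dot (bigD1 i)//= expr2 lerDl.
by apply: sumr_ge0 => k _; rewrite -expr2 sqr_ge0.
Qed.

Lemma norm2_le_norm n (u : 'cV[R]_n) : norm2 u <= n%:R * `|u|.
Proof.
rewrite -ler_sqr ?nnegrE ?mulr_ge0 ?norm2_ge0// norm2_sqr exprMn.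
have le1 i : u i 0 * u i 0 <= `|u| ^+ 2.
  by rewrite -expr2 -[u i 0 ^+ 2]real_normK ?num_real// lerXn2r ?nnegrE// mx_entry_le.
apply: le_trans (ler_sum _ (fun i _ => le1 i)) _.
rewrite sumr_const card_ord -[leLHS]mulr_natl; apply: ler_wpM2r; first exact: sqr_ge0.
by rewrite -natrX ler_nat; case: (n) => // k; rewrite leq_pmulr.
Qed.

Lemma norm2_mulmx_le m n (A : 'M[R]_(m, n)) (v : 'cV[R]_n) :
  norm2 (A *m v) <= m%:R * n%:R * `|A| * norm2 v.
Proof.
apply: le_trans (norm2_le_norm _) _; rewrite -!mulrA; apply: ler_wpM2l => //.
apply: mx_norm_le => [|i j]; first by rewrite !mulr_ge0 ?norm2_ge0.
rewrite mxE; apply: le_trans (ler_norm_sum _ _ _) _.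
have -> : n%:R * (`|A| * norm2 v) = \sum_(k < n) `|A| * norm2 v.
  by rewrite sumr_const card_ord mulr_natl.
apply: ler_sum => k _.
rewrite normrM ler_pM ?mx_entry_le// (le_trans _ (norm_le_norm2 _))// (ord1 j).
exact: mx_entry_le.
Qed.

Lemma mxnorm2_ub m n (A : 'M[R]_(m, n)) (v : 'cV[R]_n) :
  norm2 (A *m v) <= mxnorm2 A * norm2 v.
Proof.
have [->|v0] := eqVneq v 0; first by rewrite mulmx0 !norm2_0 mulr0.
have vp : 0 < norm2 v by rewrite norm2_gt0.
rewrite -ler_pdivrMr// mulrC -[X in X * _]ger0_norm ?invr_ge0 ?norm2_ge0//.
rewrite -norm2Z scalemxAr; apply: ub_le_sup; last first.
  exists ((norm2 v)^-1 *: v) => //=.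
  by rewrite norm2Z ger0_norm ?invr_ge0 ?norm2_ge0// mulVf// gt_eqF.
exists (m%:R * n%:R * `|A|) => _ [w /= w1 <-].
by rewrite (le_trans (norm2_mulmx_le _ _))// ler_piMr// !mulr_ge0.
Qed.

End MatrixNorms.

(** * The block linear system *)

Section NewtonSystem.
Context {R : realType} (n1 n2 : nat) (lmin C t : R).
Context (H1 : 'M[R]_n1) (H2 : 'M[R]_n2).
Context (M1 : 'M[R]_(n1, n2)) (M2 : 'M[R]_(n2, n1)).
Hypothesis lmin_gt0 : 0 < lmin.
Hypothesis geH1 : forall v : 'cV[R]_n1, lmin * norm2 v <= norm2 (H1 *m v).
Hypothesis geH2 : forall v : 'cV[R]_n2, lmin * norm2 v <= norm2 (H2 *m v).
Hypothesis leM1 : forall v : 'cV[R]_n2, norm2 (M1 *m v) <= C * norm2 v.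
Hypothesis leM2 : forall v : 'cV[R]_n1, norm2 (M2 *m v) <= C * norm2 v.
Hypothesis t_ge0 : 0 <= t.
Hypothesis tC : t * C <= lmin / 2.

(** Condition [tC] makes the system diagonally dominant: each equation bounds
    one block of [d] by its right-hand side plus half of the other block, and
    the two halves are absorbed after summation. *)
Lemma newton_system_bound (g1 d1 : 'cV[R]_n1) (g2 d2 : 'cV[R]_n2) :
  H1 *m d1 + t *: M1 *m d2 = - g1 -> H2 *m d2 + t *: M2 *m d1 = - g2 ->
  norm2 d1 + norm2 d2 <= 2 / lmin * (norm2 g1 + norm2 g2).
Proof.
move=> e1 e2.
have b n m (K : 'M[R]_n) (N : 'M[R]_(n, m)) (g u : 'cV[R]_n) (v : 'cV[R]_m) :
    lmin * norm2 u <= norm2 (K *m u) -> norm2 (N *m v) <= C * norm2 v ->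
    K *m u + t *: N *m v = - g ->
    lmin * norm2 u <= norm2 g + lmin / 2 * norm2 v.
  move=> Ku Nv eg; apply: le_trans Ku _.
  have -> : K *m u = - g - t *: (N *m v) by rewrite -eg -scalemxAl addrK.
  apply: le_trans (norm2B _ _) _; rewrite norm2N lerD2l norm2Z ger0_norm//.
  apply: le_trans (ler_wpM2l t_ge0 Nv) _.
  by rewrite mulrA ler_wpM2r ?norm2_ge0.
have b1 := b _ _ _ _ _ _ _ (geH1 d1) (leM1 d2) e1.
have b2 := b _ _ _ _ _ _ _ (geH2 d2) (leM2 d1) e2.
rewrite mulrAC ler_pdivlMr// mulrC; lra.
Qed.

Lemma newton_mx_unit : newton_mx H1 H2 M1 M2 t \in unitmx.
Proof.
rewrite -unitmx_tr -row_free_unit; apply: inj_row_free => w /(congr1 trmx).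
rewrite trmx_mul trmxK trmx0 -(vsubmxK w^T).
set u := usubmx _; set v := dsubmx _.
rewrite mul_block_col -col_mx0 => /eq_col_mx[e1 e2].
rewrite addrC in e2; have := @newton_system_bound 0 u 0 v.
rewrite !oppr0 !norm2_0 addr0 mulr0 => /(_ e1 e2) uv.
have u0 : norm2 u == 0 by have := norm2_ge0 u; have := norm2_ge0 v; move: uv; lra.
have v0 : norm2 v == 0 by have := norm2_ge0 u; have := norm2_ge0 v; move: uv; lra.
move: u0 v0; rewrite !norm2_eq0 => /eqP u0 /eqP v0.
by apply: trmx_inj; rewrite -(vsubmxK w^T) -/u -/v u0 v0 col_mx0 trmx0.
Qed.

End NewtonSystem.

(** * Smoothness of an objective in its two blocks *)

(** A directional derivative only sees the values of a function along a line.
    This identifies partial derivatives of an objective in one block with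
    derivatives on the product space, and derivatives of a one-variable
    restriction with directional derivatives. *)
Section Lines.
Context {R : realType} (V W Z : normedModType R).
Variables (f : V -> Z) (g : W -> Z) (p v : V) (q w : W).
Hypothesis fg : forall h : R, f (h *: v + p) = g (h *: w + q).

Let quotients :
  (fun h : R => h^-1 *: ((f \o shift p) (h *: v) - f p)) =
  (fun h : R => h^-1 *: ((g \o shift q) (h *: w) - g q)).
Proof.
have := fg 0; rewrite !scale0r !add0r => f0.
by apply/funext => h /=; rewrite fg f0.
Qed.

Lemma derive_line : 'D_v f p = 'D_w g q.
Proof. by rewrite /derive quotients. Qed.

Lemma derivable_line : derivable g q w -> derivable f p v.
Proof. by rewrite /derivable quotients. Qed.

End Lines.

Lemma cvg_mx {R : realType} (T : Type) (G : set_system T) (FG : Filter G)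
    m n (f : T -> 'M[R]_(m, n)) (A : 'M[R]_(m, n)) :
  (forall i j, (fun x => f x i j) @ G --> A i j) -> f @ G --> A.
Proof.
move=> fA; apply/cvgrPdist_le => e e0.
have := @filter_forall T ('I_m * 'I_n)%type
  (fun k x => `|A k.1 k.2 - f x k.1 k.2| <= e) G FG.
have H k : \forall x \near G, `|A k.1 k.2 - f x k.1 k.2| <= e.
  by have /cvgrPdist_le := fA k.1 k.2; apply.
move=> /(_ H); apply: filterS => x fx; apply: mx_norm_le => [|i j]; first exact: ltW.
by have := fx (i, j); rewrite !mxE.
Qed.

Section SmoothPlayer.
Context {R : realType}.

(** The consequences of twice continuous differentiability that the
    convergence proof uses. *)
Definition smooth_player n m (F : 'cV[R]_n -> 'cV[R]_m -> R) : Prop :=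
  [/\ forall z y d, is_derive z d (F ^~ y) (dot (pgrad F z y) d),
      continuous (fun p => pgrad F p.1 p.2)
    & continuous (fun p => phess F p.1 p.2)].

Lemma line_fst (U V : lmodType R) (h : R) (u x : U) (y : V) :
  h *: (u, 0) + (x, y) = (h *: u + x, y).
Proof. by congr pair; rewrite /= scaler0 add0r. Qed.

Lemma line_snd (U V : lmodType R) (h : R) (x : U) (v y : V) :
  h *: (0, v) + (x, y) = (x, h *: v + y).
Proof. by congr pair; rewrite /= scaler0 add0r. Qed.

Lemma linear_dot n (L : {linear 'cV[R]_n -> R}) (d : 'cV[R]_n) :
  L d = dot (\col_a L (delta_mx a 0)) d.
Proof.
rewrite [in LHS](matrix_sum_delta d) linear_sum; apply: eq_bigr => i _.
by rewrite big_ord1 linearZ/= mxE mulrC.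
Qed.

Lemma smooth_own1 n1 n2 (f : 'cV[R]_n1 * 'cV[R]_n2 -> R) :
  Ck 2 f -> smooth_player (own1 f).
Proof.
move=> [df ddf].
have lineE (x v : 'cV[R]_n1) (y : 'cV[R]_n2) (h : R) :
    own1 f (h *: v + x) y = f (h *: (v, 0) + (x, y)).
  by rewrite line_fst.
have gradE a x y : pgrad (own1 f) x y a 0 = 'D_(delta_mx a 0, 0) f (x, y).
  by rewrite mxE; apply: derive_line => h; exact: lineE.
have hessE a b x y : phess (own1 f) x y a b =
    'D_(0, delta_mx b 0) (fun p => 'D_(delta_mx a 0, 0) f p) (x, y).
  rewrite mxE; apply: derive_line => h; rewrite gradE.
  by rewrite line_snd.
split.
- move=> z y d; apply: DeriveDef.
    by apply: (derivable_line (lineE z d y)); exact: diff_derivable.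
  rewrite (derive_line (lineE z d y)) deriveE//.
  pose L u := 'd f (z, y) (u, 0).
  have Ll : linear L.
    move=> c u u'; rewrite /L -linearP; congr ('d f _ _).
    by congr pair; rewrite /= scaler0 addr0.
  pose LM := GRing.isLinear.Build R _ _ _ L Ll.
  pose LL : {linear 'cV[R]_n1 -> R} := HB.pack L LM.
  rewrite -[LHS]/(LL d) linear_dot; congr dot.
  by apply/colP => a; rewrite mxE gradE deriveE.
- move=> p; apply: cvg_mx => a j; rewrite (ord1 j).
  have [dg _] := ddf (delta_mx a 0, 0).
  rewrite (_ : (fun _ => _) = fun q => 'D_(delta_mx a 0, 0) f q); last first.
    by apply/funext => -[? ?]; rewrite gradE.
  rewrite gradE -surjective_pairing; exact: (differentiable_continuous (dg p)).
- move=> p; apply: cvg_mx => a b.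
  have [_ /(_ (0, delta_mx b 0)) hc] := ddf (delta_mx a 0, 0).
  rewrite (_ : (fun _ => _) =
      fun q => 'D_(0, delta_mx b 0) (fun p => 'D_(delta_mx a 0, 0) f p) q).
    by rewrite hessE -surjective_pairing; exact: hc.
  by apply/funext => -[? ?]; rewrite hessE.
Qed.

(** Exchanging the blocks turns player 2 into player 1. *)
Lemma Ck_swap (U V : normedModType R) k (f : U * V -> R) :
  Ck k f -> Ck k (fun q : V * U => f (q.2, q.1)).
Proof.
have line h (q v : V * U) :
    ((h *: v + q).2, (h *: v + q).1) = h *: (v.2, v.1) + (q.2, q.1) by [].
pose sw (q : V * U) := (q.2, q.1).
have swc : continuous sw by exact: swap_continuous.
elim: k f => [f fc q|k IH f [df ddf]] /=.
  by apply: (@continuous_comp _ _ _ sw f); [exact: swc|exact: fc].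
split=> [q|v].
  have lin : linear sw by move=> c [? ?] [? ?].
  pose LM := GRing.isLinear.Build R _ _ _ sw lin.
  pose L : {linear (V * U)%type -> (U * V)%type} := HB.pack sw LM.
  apply: (@differentiable_comp _ _ _ _ L f) => //.
  by apply: linear_differentiable; exact: swc.
have -> : (fun q => 'D_v (fun q : V * U => f (q.2, q.1)) q) =
    (fun q : V * U => 'D_(v.2, v.1) f (q.2, q.1)).
  by apply/funext => q; apply: derive_line => h; rewrite line.
exact: (IH _ (ddf (v.2, v.1))).
Qed.

Lemma smooth_own2 n1 n2 (f : 'cV[R]_n1 * 'cV[R]_n2 -> R) :
  Ck 2 f -> smooth_player (own2 f).
Proof. by move=> /Ck_swap/smooth_own1. Qed.

Lemma player_mvt n m (F : 'cV[R]_n -> 'cV[R]_m -> R) x d y (t : R) :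
  smooth_player F -> 0 < t ->
  exists2 s, 0 <= s <= t &
    F (x + t *: d) y - F x y = t * dot (pgrad F (x + s *: d) y) d.
Proof.
move=> [dF _ _] t0; pose phi (s : R) := F (x + s *: d) y.
have line (s h : R) : phi (h *: 1 + s) = F (h *: d + (x + s *: d)) y.
  by rewrite /phi scalerDl -scalerA scale1r addrCA.
have dphi (s : R) : is_derive s 1 phi (dot (pgrad F (x + s *: d) y) d).
  have [dr de] := dF (x + s *: d) y d.
  apply: DeriveDef; last first.
    by rewrite (@derive_line _ _ _ _ phi (F ^~ y) s 1 (x + s *: d) d (line s)).
  exact: (@derivable_line _ _ _ _ phi (F ^~ y) s 1 (x + s *: d) d (line s)).
have [|s st] := MVT t0 (fun s _ => dphi s).
  by apply: derivable_within_continuous => s _; exact: ex_derive.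
rewrite subr0 /phi scale0r addr0 mulrC => ->; exists s => //.
by move: st; rewrite in_itv/= => /andP[/ltW -> /ltW ->].
Qed.

End SmoothPlayer.

(** * Short steps near a point with nonzero partial gradient *)

Section NearAPoint.
Context {R : realType}.

Lemma continuous_blocks n m k l (G : 'cV[R]_n * 'cV[R]_m -> 'M[R]_(k, l))
    (x : 'cV[R]_n) (y : 'cV[R]_m) (e : R) :
  continuous G -> 0 < e ->
  exists2 delta : R, 0 < delta & forall (u : 'cV[R]_n) (v : 'cV[R]_m),
    `|u - x| < delta -> `|v - y| < delta ->
    `|G (u, v) - G (x, y)| <= e.
Proof.
move=> /(_ (x, y))/cvgrPdist_le Gc /Gc/nbhs_ballP[delta /= d0 dG].
exists delta => // u v ux vy; rewrite distrC; apply: dG.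
by split; rewrite -ball_normE /ball_ /= distrC.
Qed.

Lemma pgrad_near n m (F : 'cV[R]_n -> 'cV[R]_m -> R)
    (xs : 'cV[R]_n) (ys : 'cV[R]_m) (e : R) :
  smooth_player F -> 0 < e ->
  exists2 delta : R, 0 < delta &
    forall (x : 'cV[R]_n) (y : 'cV[R]_m), `|x - xs| < delta -> `|y - ys| < delta ->
      norm2 (pgrad F x y - pgrad F xs ys) <= e.
Proof.
move=> [_ gc _] e0; have e1 : 0 < e / n.+1%:R by rewrite divr_gt0.
have [delta d0 dF] := continuous_blocks xs ys gc e1.
exists delta => // x y /dF /[apply] /= gxy.
apply: le_trans (norm2_le_norm _) _.
apply: le_trans (ler_wpM2l (ler0n _ _) gxy) _.
rewrite mulrCA ger_pMr// ler_pdivrMr// mul1r ler_nat//.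
Qed.

Lemma pgrad_near_bounded n m (F : 'cV[R]_n -> 'cV[R]_m -> R)
    (xs : 'cV[R]_n) (ys : 'cV[R]_m) :
  smooth_player F ->
  exists2 delta : R, 0 < delta &
    forall (x : 'cV[R]_n) (y : 'cV[R]_m),
      `|x - xs| < delta -> `|y - ys| < delta ->
      norm2 (pgrad F x y) <= norm2 (pgrad F xs ys) + 1.
Proof.
move=> sF; have [delta d0 near] := pgrad_near xs ys sF ltr01.
exists delta => // x y /near /[apply] gxy.
rewrite -[pgrad F x y](subrK (pgrad F xs ys)) addrC.
by apply: le_trans (norm2D _ _) _; rewrite lerD2l.
Qed.

Lemma pgrad_near_neq0 n m (F : 'cV[R]_n -> 'cV[R]_m -> R)
    (xs : 'cV[R]_n) (ys : 'cV[R]_m) :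
  smooth_player F -> pgrad F xs ys != 0 ->
  exists2 delta : R, 0 < delta &
    forall (x : 'cV[R]_n) (y : 'cV[R]_m), `|x - xs| < delta -> `|y - ys| < delta ->
      pgrad F x y != 0.
Proof.
move=> sF gs0; have e0 : 0 < norm2 (pgrad F xs ys) / 2 by rewrite divr_gt0// norm2_gt0.
have [delta d0 near] := pgrad_near xs ys sF e0.
exists delta => // x y /near /[apply]; apply: contraTneq => ->.
by rewrite sub0r norm2N -ltNge ltr_pdivrMr// ltr_pMr ?norm2_gt0// ltr1n.
Qed.

Lemma phess_near n m (F : 'cV[R]_n -> 'cV[R]_m -> R)
    (xs : 'cV[R]_n) (ys : 'cV[R]_m) :
  smooth_player F ->
  exists2 delta : R, 0 < delta & exists2 C : R, 0 < C &
    forall (x : 'cV[R]_n) (y : 'cV[R]_m), `|x - xs| < delta -> `|y - ys| < delta ->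
      forall v, norm2 (phess F x y *m v) <= C * norm2 v.
Proof.
move=> [_ _ hc]; have [delta d0 dF] := continuous_blocks xs ys hc ltr01.
exists delta => //; exists (n.+1%:R * m.+1%:R * (`|phess F xs ys| + 1)).
  by rewrite !mulr_gt0// ltr_wpDl.
move=> x y /dF /[apply] /= hxy v.
apply: le_trans (norm2_mulmx_le _ _) _; apply: ler_wpM2r; first exact: norm2_ge0.
apply: ler_pM => //; first by rewrite ler_pM// ler_nat.
have := ler_normD (phess F xs ys) (phess F x y - phess F xs ys).
rewrite [X in `|X|]addrC subrK.
by move=> /le_trans; apply; rewrite lerD2l.
Qed.

End NearAPoint.

Section Tests.
Context {R : realType} (n m : nat) (F : 'cV[R]_n -> 'cV[R]_m -> R).
Variables alpha theta gamma lmin lmax : R.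
Hypothesis smoothF : smooth_player F.
Hypotheses (lmin_gt0 : 0 < lmin) (lmax_gt0 : 0 < lmax).
Hypotheses (alpha_lt1 : alpha < 1) (theta_gt0 : 0 < theta).

Let kappa := 2 * Num.sqrt (lmin * lmax) / (lmin + lmax).

(** The exact direction [- H^-1 g], with [g] the gradient at the shifted point,
    passes the angle test by the Kantorovich inequality and the size test
    because [H] expands by at most [lmax], both with a margin proportional to
    the norm of [g].  The Armijo test follows from the angle test and the mean
    value theorem if the gradient varies little along the step.  Hence errors of
    size [eps] are tolerated as soon as [g] has norm at least [eta] and [eps] is
    a small enough multiple of [eta]. *)
Lemma perturbed_direction_tests (eps eta : R) H (t : R)
    (x d : 'cV[R]_n) (y e : 'cV[R]_m) :
  form_between lmin lmax H -> theta < kappa -> gamma * lmax < 1 ->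
  (1 + kappa) * eps <= (kappa - theta) * eta ->
  eps <= (1 - gamma * lmax) * eta ->
  eps <= (1 - alpha) * theta * eta ->
  0 < t -> eta <= norm2 (pgrad F x (y + t *: e)) ->
  norm2 (H *m d + pgrad F x (y + t *: e)) <= eps ->
  (forall s, 0 <= s <= t ->
    norm2 (pgrad F (x + s *: d) (y + t *: e) - pgrad F x (y + t *: e)) <= eps) ->
  player_tests F alpha theta gamma t x d y e.
Proof.
move=> formH theta_kappa gamma_lmax eps1 eps2 eps3 t0.
rewrite /player_tests /=; set y' := y + t *: e; set g := pgrad F x y'.
set p := H *m d + g => eta_g peps grads.
have gH : norm2 g - eps <= norm2 (H *m d).
  rewrite lerBlDr; apply: le_trans (_ : norm2 (p - H *m d) <= _).
    by rewrite /p addrC addKr.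
  by have := norm2B p (H *m d); lra.
have d0 := norm2_ge0 d.
have kappa0 : 0 < kappa by exact: lt_trans theta_kappa.
have gd : dot g d <= - theta * norm2 g * norm2 d.
  have -> : dot g d = dot p d - dot d (H *m d).
    by rewrite dotDl (dotC d) addrC addKr.
  have pd : dot p d <= eps * norm2 d.
    apply: le_trans (ler_norm _) _; apply: le_trans (dot_CauchySchwarz _ _) _.
    exact: ler_wpM2r.
  have := kantorovich lmin_gt0 lmax_gt0 formH d; rewrite -/kappa => dHd.
  have h1 := ler_wpM2l (ltW kappa0) (ler_wpM2r d0 gH).
  have h2 : (1 + kappa) * eps <= (kappa - theta) * norm2 g.
    by apply: le_trans eps1 _; rewrite ler_wpM2l// subr_ge0 ltW.
  have := ler_wpM2r d0 h2; lra.
split=> //.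
- have [s /grads gs e1] := player_mvt x d y' smoothF t0.
  rewrite -lerBlDl e1 [alpha * t]mulrC -mulrA ler_pM2l//.
  have sd : dot (pgrad F (x + s *: d) y' - g) d <= eps * norm2 d.
    apply: le_trans (ler_norm _) _; apply: le_trans (dot_CauchySchwarz _ _) _.
    exact: ler_wpM2r.
  have -> : dot (pgrad F (x + s *: d) y') d =
      dot (pgrad F (x + s *: d) y' - g) d + dot g d by rewrite dotBl subrK.
  have h3 : eps * norm2 d <= (1 - alpha) * (theta * norm2 g * norm2 d).
    rewrite !mulrA ler_wpM2r//; apply: le_trans eps3 _.
    by rewrite ler_wpM2l// mulr_ge0 ?subr_ge0 ?ltW.
  have a0 : 0 <= 1 - alpha by rewrite subr_ge0 ltW.
  have := ler_wpM2l a0 gd; lra.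
- apply: ler_wpM2r; first exact: norm2_ge0.
  rewrite -(ler_pM2l lmax_gt0).
  apply: le_trans (norm2_form_le lmin_gt0 lmax_gt0 formH d).
  apply: le_trans gH.
  have b0 : 0 <= 1 - gamma * lmax by rewrite subr_ge0 ltW.
  have := ler_wpM2l b0 eta_g; lra.
Qed.

(** As [t] tends to 0 with bounded directions, the coupling term
    [t *: phess F x y *m e] and the displacements [t *: d] and [t *: e] become
    negligible, so the direction is a small perturbation of the exact one.  The
    bound [tb] is uniform in the point, which is what excludes vanishing step
    sizes along a convergent sequence. *)
Lemma short_step_tests (xs : 'cV[R]_n) (ys : 'cV[R]_m) (C D : R) :
  theta < kappa -> gamma * lmax < 1 ->
  pgrad F xs ys != 0 -> 0 < C -> 0 < D ->
  exists2 delta : R, 0 < delta & exists2 tb : R, 0 < tb &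
    forall (x : 'cV[R]_n) (y : 'cV[R]_m) H (t : R) (d : 'cV[R]_n) (e : 'cV[R]_m),
      `|x - xs| < delta -> `|y - ys| < delta ->
      (forall v, norm2 (phess F x y *m v) <= C * norm2 v) ->
      form_between lmin lmax H ->
      0 < t -> t <= tb -> norm2 d <= D -> norm2 e <= D ->
      H *m d + t *: phess F x y *m e = - pgrad F x y ->
      player_tests F alpha theta gamma t x d y e.
Proof.
move=> theta_kappa gamma_lmax gs0 C0 D0.
have kappa0 : 0 < kappa by exact: lt_trans theta_kappa.
have [eta eta0 gs_eta] : exists2 eta : R, 0 < eta & norm2 (pgrad F xs ys) = 2 * eta.
  exists (norm2 (pgrad F xs ys) / 2); first by rewrite divr_gt0// norm2_gt0.
  by rewrite mulrC divfK.
have [eps [eps0 eps1 eps2 eps3]] : exists eps : R,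
    [/\ 0 < eps, (1 + kappa) * eps <= (kappa - theta) * eta,
        eps <= (1 - gamma * lmax) * eta & eps <= (1 - alpha) * theta * eta].
  have k1 : 0 < 1 + kappa by rewrite addr_gt0.
  exists (Num.min ((kappa - theta) * eta / (1 + kappa))
    (Num.min ((1 - gamma * lmax) * eta) ((1 - alpha) * theta * eta))).
  rewrite [(1 + kappa) * _]mulrC -ler_pdivlMr// !ge_min !lexx !orbT.
  split=> //; rewrite !lt_min !mulr_gt0 ?subr_gt0 ?invr_gt0//.
have e40 : 0 < Num.min eta (eps / 4) by rewrite lt_min eta0 divr_gt0.
(* Two gradients near the limit point differ by at most [eps / 4 + eps / 4];
   the other [eps / 2] is left for the coupling term. *)
have [delta delta0 near] := pgrad_near xs ys smoothF e40.
exists (delta / 2); first by rewrite divr_gt0.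
exists (Num.min (delta / 4 / D) (eps / 2 / (C * D))).
  by rewrite lt_min !divr_gt0// mulr_gt0.
move=> x y H t d e xd yd hC formH t0.
rewrite le_min => /andP[]; rewrite ler_pdivlMr// => tD.
rewrite ler_pdivlMr ?mulr_gt0// => tCD dD eD eq.
have small k (s : R) (u : 'cV[R]_k) :
    0 <= s <= t -> norm2 u <= D -> `|s *: u| < delta / 2.
  move=> /andP[s0 st] uD; apply: le_lt_trans (norm_le_norm2 _) _.
  rewrite norm2Z ger0_norm//.
  have := ler_pM s0 (norm2_ge0 u) st uD; lra.
have near2 x' y' : `|x' - xs| < delta -> `|y' - ys| < delta ->
    norm2 (pgrad F x' y' - pgrad F xs ys) <= eta /\
    norm2 (pgrad F x' y' - pgrad F xs ys) <= eps / 4.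
  by move=> /near /[apply]; rewrite le_min => /andP[].
have addd k (u w z : 'cV[R]_k) : `|u - z| < delta / 2 -> `|w| < delta / 2 ->
    `|u + w - z| < delta.
  by move=> uz wz; rewrite addrAC; apply: le_lt_trans (ler_normD _ _) _; lra.
have tt : 0 <= t <= t by rewrite ltW/=.
have yt : `|y + t *: e - ys| < delta by apply: addd => //; exact: small.
have xd' : `|x - xs| < delta by lra.
have yd' : `|y - ys| < delta by lra.
have [g'1 g'2] := near2 _ _ xd' yt.
have [_ g2] := near2 _ _ xd' yd'.
have dist k (u w z : 'cV[R]_k) : norm2 (u - z) <= eps / 4 ->
    norm2 (w - z) <= eps / 4 -> norm2 (u - w) <= eps / 2.
  move=> uz wz; rewrite -(subrKA z) -[z - w]opprB.
  have -> : eps / 2 = eps / 4 + eps / 4 by field.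
  by apply: le_trans (norm2B _ _) _; exact: lerD.
apply: (perturbed_direction_tests formH theta_kappa gamma_lmax eps1 eps2 eps3) => //.
- have := norm2B (pgrad F x (y + t *: e)) (pgrad F x (y + t *: e) - pgrad F xs ys).
  rewrite opprB addrC subrK gs_eta mulr_natl mulr2n -lerBlDr.
  by apply: le_trans; rewrite -addrA lerDl subr_ge0.
- have -> : H *m d + pgrad F x (y + t *: e) =
      (pgrad F x (y + t *: e) - pgrad F x y) - t *: (phess F x y *m e).
    rewrite [RHS]addrAC [LHS]addrC -addrA; congr (_ + _).
    rewrite -scalemxAl in eq; rewrite -[LHS](addrK (t *: (phess F x y *m e))) eq.
    exact: addrC.
  apply: le_trans (norm2B _ _) _.
  rewrite (splitr eps) norm2Z gtr0_norm//; apply: lerD; first exact: dist g'2 g2.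
  apply: le_trans tCD; apply: ler_wpM2l; first exact: ltW.
  by apply: le_trans (hC e) _; rewrite ler_wpM2l// ltW.
- move=> s st; have [_ gs] := near2 _ _ (addd _ _ _ _ xd (small _ _ _ st dD)) yt.
  apply: le_trans (dist _ _ _ _ gs g'2) _.
  by rewrite ler_pdivrMr// ler_peMr ?(ltW eps0)// ler1n.
Qed.

End Tests.

(** * The algorithm *)

Section Algorithm.
Context {R : realType} (n1 n2 : nat) (f1 f2 : 'cV[R]_n1 * 'cV[R]_n2 -> R).
Context (alpha tau theta gamma : R).

Lemma mixed_blockP n m (F : 'cV[R]_n -> 'cV[R]_m -> R) (t : R) x y :
  mixed_block F tau t x y = phess F x y \/
  pgrad F x y = 0 /\ mixed_block F tau t x y = 0.
Proof.
rewrite /mixed_block norm2_gt0; have [g0|g0] := eqVneq (pgrad F x y) 0 => /=.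
  by case: ifP; [left|right].
by left.
Qed.

(** Although the blocks are kept after a singular matrix and selected again
    after a failed test, a block other than the mixed Hessian can only occur
    when the own gradient vanishes. *)
Lemma inner_stateP (H1 : 'M[R]_n1) (H2 : 'M[R]_n2) x (t : R) M1 M2 :
  inner_state f1 f2 alpha tau theta gamma H1 H2 x t M1 M2 ->
  [/\ 0 < t <= 1,
      M1 = phess (own1 f1) x.1 x.2 \/ pgrad (own1 f1) x.1 x.2 = 0 /\ M1 = 0
    & M2 = phess (own2 f2) x.2 x.1 \/ pgrad (own2 f2) x.2 x.1 = 0 /\ M2 = 0].
Proof.
have half (s : R) : 0 < s <= 1 -> 0 < s / 2 <= 1.
  by move=> /andP[s0 s1]; apply/andP; split; lra.
elim=> {t M1 M2} [|t M1 M2 _ [/half t01 ? ?] _|t M1 M2 d _ [/half t01 _ _] _ _ _].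
- by split; [rewrite ltr01/= lexx|exact: mixed_blockP|exact: mixed_blockP].
- by split.
- by split => //; exact: mixed_blockP.
Qed.

Lemma newton_directionP (H1 : 'M[R]_n1) (H2 : 'M[R]_n2) M1 M2 (t : R) x d :
  newton_direction f1 f2 H1 H2 M1 M2 t x d ->
  H1 *m d.1 + t *: M1 *m d.2 = - pgrad (own1 f1) x.1 x.2 /\
  H2 *m d.2 + t *: M2 *m d.1 = - pgrad (own2 f2) x.2 x.1.
Proof.
rewrite /newton_direction mul_block_col opp_col_mx => /eq_col_mx[e1 e2].
by rewrite [H2 *m _ + _]addrC.
Qed.

(** Only rejected or singular trial steps are halved, and both are too long
    to be in [(0, tb]]. *)
Lemma inner_state_step_ge (H1 : 'M[R]_n1) (H2 : 'M[R]_n2) x (tb : R) :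
  tb <= 1 ->
  (forall (t : R) M1 M2, 0 < t <= tb ->
     inner_state f1 f2 alpha tau theta gamma H1 H2 x t M1 M2 ->
     newton_mx H1 H2 M1 M2 t \in unitmx /\
     forall d, newton_direction f1 f2 H1 H2 M1 M2 t x d ->
       line_search_tests f1 f2 alpha theta gamma t x d) ->
  forall (t : R) M1 M2,
    inner_state f1 f2 alpha tau theta gamma H1 H2 x t M1 M2 -> tb / 2 <= t.
Proof.
move=> tb1 ok t M1 M2; have ok' s N1 N2 :
    inner_state f1 f2 alpha tau theta gamma H1 H2 x s N1 N2 -> s <= tb ->
    newton_mx H1 H2 N1 N2 s \in unitmx /\
    forall d, newton_direction f1 f2 H1 H2 N1 N2 s x d ->
      line_search_tests f1 f2 alpha theta gamma s x d.
  by move=> st stb; apply: ok => //; have [/andP[-> _] _ _] := inner_stateP st.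
case=> [|s N1 N2 st sing|s N1 N2 d st _ nd rej].
- by rewrite ler_pdivrMr// mul1r (le_trans tb1)// ler1n.
- rewrite ler_pM2r// leNgt; apply/negP => /ltW /(ok' _ _ _ st)[unit _].
  by rewrite unit in sing.
- rewrite ler_pM2r// leNgt; apply/negP => /ltW /(ok' _ _ _ st)[_ /(_ _ nd)].
  exact: rej.
Qed.

Lemma pgrad_le n m (H : 'M[R]_n) (M : 'M[R]_(n, m)) (lmin lmax C t : R) g d e :
  0 < lmin -> 0 < lmax -> form_between lmin lmax H ->
  (forall v, norm2 (M *m v) <= C * norm2 v) -> 0 < t <= 1 ->
  H *m d + t *: M *m e = - g -> norm2 g <= lmax * norm2 d + `|C| * norm2 e.
Proof.
move=> lmin0 lmax0 formH MC /andP[t0 t1] eg; rewrite -norm2N -eg.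
apply: le_trans (norm2D _ _) _; apply: lerD.
  exact: norm2_form_le lmin0 lmax0 formH d.
rewrite -scalemxAl norm2Z gtr0_norm//.
apply: le_trans (_ : norm2 (M *m e) <= _); first by rewrite ler_piMl ?norm2_ge0.
by apply: le_trans (MC e) _; rewrite ler_wpM2r ?norm2_ge0// ler_norm.
Qed.

Context (H1 : nat -> 'M[R]_n1) (H2 : nat -> 'M[R]_n2).
Context (x : nat -> 'cV[R]_n1 * 'cV[R]_n2) (t : nat -> R).
Context (d : nat -> 'cV[R]_n1 * 'cV[R]_n2).
Context (lmin lmax : R).
Hypothesis x_gen : generated_by_algorithm f1 f2 alpha tau theta gamma H1 H2 x t d.
Hypothesis spdH : uniformly_spd lmin lmax H1 H2.

Let lmin_gt0 : 0 < lmin. Proof. by case: spdH. Qed.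

Let lmax_gt0 : 0 < lmax.
Proof. by case: spdH => lmin0 /(lt_le_trans lmin0). Qed.

Let formH1 k : form_between lmin lmax (H1 k).
Proof. by case: spdH => _ _ /(_ k)[s e _ _]; exact: eigenvalues_form_between. Qed.

Let formH2 k : form_between lmin lmax (H2 k).
Proof. by case: spdH => _ _ /(_ k)[_ _ s e]; exact: eigenvalues_form_between. Qed.

Let step k : exists M1 M2,
  [/\ inner_state f1 f2 alpha tau theta gamma (H1 k) (H2 k) (x k) (t k) M1 M2,
      newton_direction f1 f2 (H1 k) (H2 k) M1 M2 (t k) (x k) (d k)
    & x k.+1 = x k + t k *: d k].
Proof. by have [_ _ [M1 [M2 [s _ nd _ e]]]] := x_gen k; exists M1, M2. Qed.

(** The Newton equations bound the gradients by a constant multiple of [d k]. *)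
Lemma gradients_cvg0 (G : set_system nat) (FG : Filter G) (C : R) :
  d @ G --> (0 : 'cV[R]_n1 * 'cV[R]_n2) ->
  (\forall k \near G,
    (forall v, norm2 (phess (own1 f1) (x k).1 (x k).2 *m v) <= C * norm2 v) /\
    (forall v, norm2 (phess (own2 f2) (x k).2 (x k).1 *m v) <= C * norm2 v)) ->
  (fun k => pgrad (own1 f1) (x k).1 (x k).2) @ G --> (0 : 'cV[R]_n1) /\
  (fun k => pgrad (own2 f2) (x k).2 (x k).1) @ G --> (0 : 'cV[R]_n2).
Proof.
move=> d0 hessC.
pose K : R := lmax * (n1 + n2)%:R + `|C| * (n1 + n2)%:R + 1.
have K0 : 0 < K by rewrite ltr_wpDl// addr_ge0// mulr_ge0// (ltW lmax_gt0).
have dle k : `|(d k).1| <= `|d k| /\ `|(d k).2| <= `|d k|.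
  by rewrite prod_normE /= !le_max !lexx orbT.
have nle k : norm2 (d k).1 <= (n1 + n2)%:R * `|d k| /\
             norm2 (d k).2 <= (n1 + n2)%:R * `|d k|.
  have [d1 d2] := dle k.
  by split; apply: le_trans (norm2_le_norm _) _; apply: ler_pM;
     rewrite ?ler_nat ?leq_addr ?leq_addl.
have Kle k (u v : R) : u <= (n1 + n2)%:R * `|d k| -> v <= (n1 + n2)%:R * `|d k| ->
    lmax * u + `|C| * v <= K * `|d k|.
  move=> ud vd; rewrite /K !mulrDl mul1r -!mulrA ler_wpDr// lerD//.
    by rewrite ler_pM2l.
  by rewrite ler_wpM2l.
have gle : \forall k \near G,
    `|pgrad (own1 f1) (x k).1 (x k).2| <= K * `|d k| /\
    `|pgrad (own2 f2) (x k).2 (x k).1| <= K * `|d k|.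
  apply: filterS hessC => k [h1 h2].
  have [M1 [M2 [/inner_stateP[t01 M1E M2E] /newton_directionP[e1 e2] _]]] := step k.
  have [d1 d2] := nle k.
  split; apply: le_trans (norm_le_norm2 _) _.
    case: M1E => [M1E|[-> _]]; last by rewrite norm2_0 mulr_ge0// ltW.
    rewrite M1E in e1; apply: le_trans (Kle _ _ _ d1 d2).
    exact: pgrad_le (formH1 k) h1 t01 e1.
  case: M2E => [M2E|[-> _]]; last by rewrite norm2_0 mulr_ge0// ltW.
  rewrite M2E in e2; apply: le_trans (Kle _ _ _ d2 d1).
  exact: pgrad_le (formH2 k) h2 t01 e2.
have dK e : 0 < e -> \forall k \near G, K * `|d k| <= e.
  move=> e0; have eK : 0 < e / K by rewrite divr_gt0.
  apply: filterS (cvgr0_norm_le _ d0 _ eK) => k.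
  by rewrite ler_pdivlMr// mulrC.
by split; apply/cvgr0Pnorm_le => e /dK; apply: filterS2 gle => k [g1 g2];
  apply: le_trans.
Qed.

Context (xs : 'cV[R]_n1 * 'cV[R]_n2).
Hypotheses (smooth1 : smooth_player (own1 f1)) (smooth2 : smooth_player (own2 f2)).
Hypothesis x_cvg : x @ \oo --> xs.

Let x_near (e : R) : 0 < e ->
  \forall k \near \oo, `|(x k).1 - xs.1| < e /\ `|(x k).2 - xs.2| < e.
Proof.
move=> e0; have /cvgrPdistC_lt/(_ _ e0) := x_cvg; apply: filterS => k.
by rewrite prod_normE /= gt_max => /andP[].
Qed.

Let hess_bound : exists2 C : R, 0 < C & \forall k \near \oo,
  (forall v, norm2 (phess (own1 f1) (x k).1 (x k).2 *m v) <= C * norm2 v) /\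
  (forall v, norm2 (phess (own2 f2) (x k).2 (x k).1 *m v) <= C * norm2 v).
Proof.
have [e1 e10 [C1 C10 h1]] := phess_near xs.1 xs.2 smooth1.
have [e2 e20 [C2 C20 h2]] := phess_near xs.2 xs.1 smooth2.
exists (C1 + C2); first exact: addr_gt0.
apply: filterS2 (x_near e10) (x_near e20) => k [a1 a2] [b1 b2]; split=> v.
  apply: le_trans (h1 _ _ a1 a2 v) _.
  by rewrite ler_wpM2r ?norm2_ge0// lerDl ltW.
apply: le_trans (h2 _ _ b2 b1 v) _.
by rewrite ler_wpM2r ?norm2_ge0// lerDr ltW.
Qed.

(** With step sizes bounded below, [d k = (t k)^-1 *: (x k.+1 - x k)] tends to 0
    together with the increments of the convergent sequence. *)
Lemma long_steps_stationary (c : R) :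
  0 < c -> (\forall k \near \oo, c <= t k) ->
  pgrad (own1 f1) xs.1 xs.2 = 0 /\ pgrad (own2 f2) xs.2 xs.1 = 0.
Proof.
move=> c0 tc; have [C C0 hC] := hess_bound.
have d0 : d @ \oo --> (0 : 'cV[R]_n1 * 'cV[R]_n2).
  apply/cvgr0Pnorm_le => e e0.
  have ec : 0 < c * e / 2 by rewrite divr_gt0 ?mulr_gt0.
  have /cvgrPdistC_le/(_ _ ec) xe := x_cvg.
  have xe' : \forall k \near \oo, `|x k.+1 - xs| <= c * e / 2.
    by case: (xe) => N _ xN; exists N => // k /= Nk; apply: xN; exact: leqW.
  near=> k.
  have [_ [_ [_ _ xE]]] := step k.
  have tk : c <= t k by near: k.
  have : `|t k *: d k| <= c * e.
    have -> : t k *: d k = (x k.+1 - xs) - (x k - xs).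
      by rewrite xE opprB subrKA addrAC subrr add0r.
    rewrite (splitr (c * e)); apply: le_trans (ler_normB _ _) _.
    by apply: lerD; near: k.
  rewrite normrZ gtr0_norm; last exact: lt_le_trans tk.
  move=> /(le_trans (ler_wpM2r (normr_ge0 _) tk)).
  by rewrite ler_pM2l.
have [g1 g2] := gradients_cvg0 _ d0 hC.
have [_ c1 _] := smooth1; have [_ c2 _] := smooth2.
have x_cvg' : (fun k => ((x k).2, (x k).1)) @ \oo --> (xs.2, xs.1).
  apply/cvgrPdistC_lt => e /x_near; apply: filterS => k [x1 x2].
  by rewrite prod_normE /= gt_max x1 x2.
have L1 := continuous_cvg _ (c1 xs) x_cvg.
have L2 := continuous_cvg _ (c2 (xs.2, xs.1)) x_cvg'.
by split; [exact: (norm_cvg_unique (L1 _) g1)|exact: (norm_cvg_unique (L2 _) g2)].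
Unshelve. all: by end_near.
Qed.

(** Near a point where both gradients are nonzero both mixed blocks are the
    Hessians, so for small trial steps the system is diagonally dominant, its
    solutions are bounded by [D], and both players pass their tests. *)
Lemma steps_bounded_below :
  alpha < 1 -> 0 < theta -> small_parameters lmin lmax theta gamma ->
  pgrad (own1 f1) xs.1 xs.2 != 0 -> pgrad (own2 f2) xs.2 xs.1 != 0 ->
  exists2 c : R, 0 < c & \forall k \near \oo, c <= t k.
Proof.
move=> alpha1 theta0 [theta_kappa]; rewrite -div1r ltr_pdivlMr// => gamma_lmax g10 g20.
have [C C0 hC] := hess_bound.
have [e1 e10 G1] := pgrad_near_bounded xs.1 xs.2 smooth1.
have [e2 e20 G2] := pgrad_near_bounded xs.2 xs.1 smooth2.
pose S := (norm2 (pgrad (own1 f1) xs.1 xs.2) + 1) +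
  (norm2 (pgrad (own2 f2) xs.2 xs.1) + 1).
have S0 : 0 < S by rewrite addr_gt0// ltr_wpDl ?norm2_ge0.
pose D := 2 / lmin * S.
have D0 : 0 < D by rewrite mulr_gt0// divr_gt0.
have [r1 r10 [tb1 tb10 T1]] := short_step_tests smooth1 lmin_gt0 lmax_gt0 alpha1
  theta0 theta_kappa gamma_lmax g10 C0 D0.
have [r2 r20 [tb2 tb20 T2]] := short_step_tests smooth2 lmin_gt0 lmax_gt0 alpha1
  theta0 theta_kappa gamma_lmax g20 C0 D0.
(* Beyond the thresholds of the two players, [tb <= 1] accounts for the initial
   trial step and [tb * C <= lmin / 2] is diagonal dominance. *)
pose tb := Num.min (Num.min tb1 tb2) (Num.min 1 (lmin / 2 / C)).
have tb0 : 0 < tb by rewrite !lt_min tb10 tb20 ltr01 !divr_gt0.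
exists (tb / 2); first by rewrite divr_gt0.
have [p1 p10 P1] := pgrad_near_neq0 smooth1 g10.
have [p2 p20 P2] := pgrad_near_neq0 smooth2 g20.
near=> k.
have [hC1 hC2] :
    (forall v, norm2 (phess (own1 f1) (x k).1 (x k).2 *m v) <= C * norm2 v) /\
    (forall v, norm2 (phess (own2 f2) (x k).2 (x k).1 *m v) <= C * norm2 v)
  by near: k.
have [xe11 xe12] : `|(x k).1 - xs.1| < e1 /\ `|(x k).2 - xs.2| < e1
  by near: k; exact: x_near.
have [xe21 xe22] : `|(x k).1 - xs.1| < e2 /\ `|(x k).2 - xs.2| < e2
  by near: k; exact: x_near.
have [xr11 xr12] : `|(x k).1 - xs.1| < r1 /\ `|(x k).2 - xs.2| < r1
  by near: k; exact: x_near.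
have [xr21 xr22] : `|(x k).1 - xs.1| < r2 /\ `|(x k).2 - xs.2| < r2
  by near: k; exact: x_near.
have [xp11 xp12] : `|(x k).1 - xs.1| < p1 /\ `|(x k).2 - xs.2| < p1
  by near: k; exact: x_near.
have [xp21 xp22] : `|(x k).1 - xs.1| < p2 /\ `|(x k).2 - xs.2| < p2
  by near: k; exact: x_near.
have [M1 [M2 [st _ _]]] := step k.
apply: inner_state_step_ge st; first by rewrite !ge_min lexx !orbT.
move=> s {M1 M2} M1 M2 /andP[s0].
rewrite !le_min => /andP[/andP[sb1 sb2] /andP[_ sC]] st.
have {st} [_ M1E M2E] := inner_stateP st.
have {M1E} -> : M1 = phess (own1 f1) (x k).1 (x k).2.
  by case: M1E => // -[/eqP]; rewrite (negbTE (P1 _ _ xp11 xp12)).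
have {M2E} -> : M2 = phess (own2 f2) (x k).2 (x k).1.
  by case: M2E => // -[/eqP]; rewrite (negbTE (P2 _ _ xp22 xp21)).
rewrite ler_pdivlMr// in sC.
have K1 := norm2_form_ge (formH1 k); have K2 := norm2_form_ge (formH2 k).
split; first exact: newton_mx_unit K1 K2 hC1 hC2 (ltW s0) sC.
move=> d' /newton_directionP[q1 q2].
have dD : norm2 d'.1 + norm2 d'.2 <= D.
  apply: le_trans (newton_system_bound lmin_gt0 K1 K2 hC1 hC2 (ltW s0) sC q1 q2) _.
  rewrite ler_pM2l ?divr_gt0//; apply: lerD; [exact: G1|exact: G2].
have d1D : norm2 d'.1 <= D by apply: le_trans dD; rewrite lerDl norm2_ge0.
have d2D : norm2 d'.2 <= D by apply: le_trans dD; rewrite lerDr norm2_ge0.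
split; first exact: T1 xr11 xr12 hC1 (formH1 k) s0 sb1 d1D d2D q1.
exact: T2 xr22 xr21 hC2 (formH2 k) s0 sb2 d2D d1D q2.
Unshelve. all: by end_near.
Qed.

End Algorithm.

Theorem theorem4p1 (R : realType) (n1 n2 : nat)
    (f1 f2 : 'cV[R]_n1 * 'cV[R]_n2 -> R) (alpha tau theta gamma : R)
    (H1 : nat -> 'M[R]_n1) (H2 : nat -> 'M[R]_n2)
    (x : nat -> 'cV[R]_n1 * 'cV[R]_n2) (t : nat -> R)
    (d : nat -> 'cV[R]_n1 * 'cV[R]_n2)
    (f1_C2 : Ck 2 f1) (f2_C2 : Ck 2 f2)
    (alpha01 : 0 < alpha < 1) (tau01 : 0 < tau <= 1)
    (theta_gt0 : 0 < theta) (gamma_gt0 : 0 < gamma)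
    (x_gen : generated_by_algorithm f1 f2 alpha tau theta gamma H1 H2 x t d) :
  [/\
    (exists lmin lmax : R, uniformly_spd lmin lmax H1 H2) ->
    forall N' : set nat, infinite_set N' ->
      d @ within N' \oo --> (0 : 'cV[R]_n1 * 'cV[R]_n2) ->
      (exists C : R, forall k, N' k ->
         mxnorm2 (phess (own1 f1) (x k).1 (x k).2) <= C /\
         mxnorm2 (phess (own2 f2) (x k).2 (x k).1) <= C) ->
      (fun k => pgrad (own1 f1) (x k).1 (x k).2) @ within N' \oo
        --> (0 : 'cV[R]_n1) /\
      (fun k => pgrad (own2 f2) (x k).2 (x k).1) @ within N' \oo
        --> (0 : 'cV[R]_n2),
    forall lmin lmax : R,
      uniformly_spd lmin lmax H1 H2 ->
      small_parameters lmin lmax theta gamma ->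
      locally_lipschitz_grad (own1 f1) -> locally_lipschitz_grad (own2 f2) ->
      grad_expansions f1 f2 x ->
      forall xs : 'cV[R]_n1 * 'cV[R]_n2, x @ \oo --> xs ->
        pgrad (own1 f1) xs.1 xs.2 = 0 \/ pgrad (own2 f2) xs.2 xs.1 = 0
    & (exists lmin lmax : R, uniformly_spd lmin lmax H1 H2) ->
      locally_lipschitz_grad (own1 f1) -> locally_lipschitz_grad (own2 f2) ->
      grad_expansions f1 f2 x ->
      Ck 3 f1 -> Ck 3 f2 ->
      forall xs : 'cV[R]_n1 * 'cV[R]_n2, x @ \oo --> xs ->
        (exists c : R, 0 < c /\ forall k, c <= t k) ->
        pgrad (own1 f1) xs.1 xs.2 = 0 /\ pgrad (own2 f2) xs.2 xs.1 = 0].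
Proof.
have smooth1 := smooth_own1 f1_C2; have smooth2 := smooth_own2 f2_C2.
split.
- move=> [lmin [lmax spdH]] N' _ d0 [C hC].
  apply: (gradients_cvg0 x_gen spdH _ d0 (C := C)).
  apply: filterS (withinT N' _) => k /hC[h1 h2].
  by split=> v; apply: le_trans (mxnorm2_ub _ _) _; rewrite ler_wpM2r ?norm2_ge0.
- move=> lmin lmax spdH params _ _ _ xs x_cvg.
  have [g1|g1] := eqVneq (pgrad (own1 f1) xs.1 xs.2) 0; first by left.
  have [g2|g2] := eqVneq (pgrad (own2 f2) xs.2 xs.1) 0; first by right.
  have alpha1 : alpha < 1 by case/andP: alpha01.
  have [c c0 tc] := steps_bounded_below x_gen spdH smooth1 smooth2 x_cvg alpha1
    theta_gt0 params g1 g2.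
  by have [-> _] := long_steps_stationary x_gen spdH smooth1 smooth2 x_cvg c0 tc; left.
- move=> [lmin [lmax spdH]] _ _ _ _ _ xs x_cvg [c [c0 tc]].
  have {}tc : \forall k \near \oo, c <= t k by exact: nearW.
  exact (long_steps_stationary x_gen spdH smooth1 smooth2 x_cvg c0 tc).
Qed.
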